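(* Let $B$ be a standard one-dimensional Brownian motion, let $0<\gamma<1/4$, and let $f_\gamma$ be the Cantor function on the interval $[1,2]$ associated with the middle $(1-2\gamma)$-Cantor set. Then, with positive probability, the set $\mathcal{Z}(B-f_\gamma)$ has isolated points.
   Context: $B=(B(t))_{t\ge0}$ starts at $0$. For a real function $g$ on a subset of $[0,\infty)$, $\mathcal{Z}(g)$ is the set of zeros of $g$ in $(0,\infty)$. Cantor set: let $I=[1,2]$. Let $\mathfrak{C}_{\gamma,1}$ consist of the two closed subintervals of $I$ of length $\gamma|I|$ sharing respectively the left and the right endpoint with $I$. Recursively, $\mathfrak{C}_{\gamma,n+1}$ consists of, for each $J\in\mathfrak{C}_{\gamma,n}$, the two closed subintervals of $J$ of length $\gamma^{n+1}|I|$ sharing respectively the left and the right endpoint with $J$. Let $C_{\gamma,n}$ be the union of the intervals in $\mathfrak{C}_{\gamma,n}$; the middle $(1-2\gamma)$-Cantor set is $C_\gamma=\bigcap_{n\ge1}C_{\gamma,n}$. Cantor function: $f_{\gamma,1}$ is $0$ at the left endpoint of $I$, $1$ at the right endpoint, $1/2$ on $I\setminus C_{\gamma,1}$, and linear on each interval of $\mathfrak{C}_{\gamma,1}$ (continuous). Recursively, $f_{\gamma,n+1}$ agrees with $f_{\gamma,n}$ off $C_{\gamma,n}$, and for every $J=[s,t]\in\mathfrak{C}_{\gamma,n}$ it agrees with $f_{\gamma,n}$ at $s$ and $t$, equals $(f_{\gamma,n}(s)+f_{\gamma,n}(t))/2$ on $J\setminus C_{\gamma,n+1}$ and is linear on each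 interval of $\mathfrak{C}_{\gamma,n+1}$ (continuous). The functions $f_{\gamma,n}$ converge uniformly on $I$, and $f_\gamma=\lim_n f_{\gamma,n}$. The function is extended by $f_\gamma=0$ on $[0,1)$ and $f_\gamma=1$ on $(2,\infty)$. *)

(* Defs.v *)
From HB Require Import structures.
From mathcomp Require Import all_boot all_order all_algebra.
From mathcomp Require Import all_classical all_reals all_analysis.
From mathcomp Require Import measurable_realfun.

Set Implicit Arguments.
Unset Strict Implicit.
Unset Printing Implicit Defensive.

Import Order.TTheory GRing.Theory Num.Theory.
Import numFieldNormedType.Exports.

Local Open Scope classical_set_scope.
Local Open Scope ring_scope.

Section Cantor.
Context {R : realType}.
Implicit Types (gamma x : R) (J : R * R) (g : R -> R).

(* The closed interval [s, t] is encoded by the pair (s, t).  Level 0 is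
   {[1, 2]}; since |I| = 1, the intervals of level n have length gamma ^+ n. *)
Fixpoint cantor_intervals gamma (n : nat) : seq (R * R) :=
  if n is m.+1 then
    flatten [seq [:: (J.1, J.1 + gamma ^+ m.+1); (J.2 - gamma ^+ m.+1, J.2)]
            | J <- cantor_intervals gamma m]
  else [:: (1, 2)].

(* On J = [s, t]: the continuous function equal to g at s and t, constant equal
   to (g s + g t) / 2 on ]s + l, t - l[, and linear on [s, s + l] and
   [t - l, t]. *)
Definition cantor_step g (l : R) J x : R :=
  let: (s, t) := J in
  let mid := (g s + g t) / 2 in
  if x <= s + l then g s + (mid - g s) * ((x - s) / l)
  else if x < t - l then mid
  else mid + (g t - mid) * ((x - (t - l)) / l).

(* Meaningful for x in [1, 2] and 0 < gamma < 1/2, when the intervals of each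
   level are pairwise disjoint: at most one J below contains x, and f_(n+1)
   agrees with f_n when there is none.  The recursion is started one step
   earlier than usual, from the linear function f_0 on the single interval
   [1, 2]; the first step then produces the usual f_1. *)
Fixpoint cantor_approx gamma (n : nat) : R -> R :=
  if n is m.+1 then
    fun x => foldr
      (fun J y => if J.1 <= x <= J.2
                  then cantor_step (cantor_approx gamma m) (gamma ^+ m.+1) J x
                  else y)
      (cantor_approx gamma m x) (cantor_intervals gamma m)
  else fun x => x - 1.

Definition cantor_fun gamma x : R :=
  if x < 1 then 0 else if 2 < x then 1
  else limn (fun n => cantor_approx gamma n x).

End Cantor.

Definition zeros {R : realType} (g : R -> R) : set R :=
  [set t | 0 < t /\ g t = 0].

Section Brownian.
Context {d : measure_display} {T : measurableType d} {R : realType}.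
Variable P : probability T R.

(* Taking some of the A i to be setT gives the product rule for every
   subfamily. *)
Definition mutually_independent (n : nat) (X : 'I_n -> {RV P >-> R}) : Prop :=
  forall A : 'I_n -> set R, (forall i, measurable (A i)) ->
    P (\bigcap_i (X i @^-1` A i)) = (\prod_(i < n) P (X i @^-1` A i))%E.

Definition increment (B : R -> {RV P >-> R}) (s t : R) : {RV P >-> R} :=
  B t \- B s.

(* A process on [0, +oo[ is given as a family indexed by R, of which only the
   values at nonnegative times matter.  The second argument of normal_prob is
   the standard deviation. *)
Definition is_standard_brownian_motion (B : R -> {RV P >-> R}) : Prop :=
  [/\ {ae P, forall w, B 0 w = 0},
      forall (n : nat) (t : nat -> R), 0 <= t 0%N ->
        (forall i, (i < n)%N -> t i <= t i.+1) ->
        mutually_independent (fun i : 'I_n => increment B (t i) (t i.+1)),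
      forall s t : R, 0 <= s -> s < t -> forall A : set R, measurable A ->
        distribution P (increment B s t) A = normal_prob 0 (Num.sqrt (t - s)) A &
      {ae P, forall w, {within `[0, +oo[, continuous (fun t : R => B t w)}}].

(* Avoids requiring S itself to be measurable: paths are only almost surely
   continuous, so that S may be measurable only for the completion of P.  For
   measurable S this is 0 < P S. *)
Definition with_positive_probability (S : set T) : Prop :=
  exists E : set T, [/\ measurable E, E `<=` S & (0 < P E)%E].

End Brownian.

(* Main.v *)
Require Import Defs.
From HB Require Import structures.
From mathcomp Require Import all_boot all_order all_algebra.
From mathcomp Require Import all_classical all_reals all_analysis.
From mathcomp Require Import measurable_realfun.
From mathcomp Require Import ring lra.

Set Implicit Arguments.
Unset Strict Implicit.
Unset Printing Implicit Defensive.

Import Order.TTheory GRing.Theory Num.Theory.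
Import numFieldNormedType.Exports.

Local Open Scope classical_set_scope.
Local Open Scope ring_scope.

(** Let [J] range over the intervals of the Cantor construction contained in
    [J_0 = [1, 1 + gamma^m]], and choose [theta] with
    [sqrt gamma < theta < 1/2].  Call a path good if, for every such [J] of
    level [n], [B] oscillates by at most [8 theta^n] on [J] and
    [|B - f| > 32 theta^n] at both endpoints of [J].  If in addition
    [0 < B(1) < 2^-m / 2], then [B - f] changes sign on [J_0]; as [B] moves
    little across the gap of [J], where [f] is constant, the sign change is
    inherited by one of the two children, and the resulting nested intervals
    shrink to a zero of [B - f].  It is the only zero in [J_0]: on the part of
    [J] to the left of the selected child, the monotonicity of [f] and the small
    oscillation of [B] keep [B - f] as positive as at the left endpoint of that
    child, and symmetrically to the right.

    The initial condition has probability at least [c 2^-m].  By union bounds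
    over the [2^p] intervals of level [m + p], the endpoint condition fails with
    probability [O(theta^m)], since the density of [B(t)] is bounded for
    [t >= 1] and [2 theta < 1], and the oscillation condition fails with
    probability [O(4^-m)], since [theta^2 > gamma] and Gaussian tails decay
    faster than any power.  For large [m] the good paths therefore have positive
    probability. *)

Lemma foldr_if_none (A : eqType) (V : Type) (p : pred A) (h : A -> V) v s :
  {in s, forall a, ~~ p a} -> foldr (fun a w => if p a then h a else w) v s = v.
Proof.
elim: s => //= a s IHs pN; rewrite (negPf (pN a (mem_head a s))).
by apply: IHs => c cs; apply: pN; rewrite inE cs orbT.
Qed.

Lemma foldr_if_uniq (A : eqType) (V : Type) (p : pred A) (h : A -> V) v s a :
  a \in s -> p a -> {in s, forall c, p c -> c = a} ->
  foldr (fun a w => if p a then h a else w) v s = h a.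
Proof.
elim: s => //= c s IHs; rewrite inE => ca pa uniq_a.
case: ifPn => [/(uniq_a c (mem_head c s)) -> //|pcN].
apply: IHs => // [|e es]; last by apply: uniq_a; rewrite inE es orbT.
by case/predU1P: ca => // ac; rewrite -ac pa in pcN.
Qed.

Lemma near_expr_lt (R : archiRealFieldType) (z e : R) :
  0 <= z < 1 -> 0 < e -> \forall n \near \oo, z ^+ n < e.
Proof.
move=> /andP[z0 z1] e0; apply: cvgr_lt e0.
by apply: cvg_expr; rewrite ger0_norm.
Qed.

Lemma dyadic_double (F : numFieldType) n i :
  i.*2%:R / 2 ^+ n.+1 = i%:R / 2 ^+ n :> F.
Proof. by rewrite -muln2 natrM exprS; field; rewrite expf_neq0. Qed.

Lemma dyadic_doubleS (F : numFieldType) n i :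
  i.*2.+1%:R / 2 ^+ n.+1 = (i%:R / 2 ^+ n + i.+1%:R / 2 ^+ n) / 2 :> F.
Proof.
rewrite -!natr1 -muln2 natrM exprS.
by field; rewrite expf_neq0.
Qed.

Lemma cvg_geometric_increment (R : realType) (V : completeNormedModType R)
    (u : V ^nat) (C z : R) :
  0 <= C -> 0 <= z < 1 -> (forall n, `|u n.+1 - u n| <= C * z ^+ n) -> cvgn u.
Proof.
move=> C0 /andP[z0 z1] du.
have -> : u = (fun n => u 0%N + series (telescope u) n).
  by apply/funext => n; exact: eq_sum_telescope.
apply: is_cvgD; first exact: is_cvg_cst.
apply: normed_cvg; apply: (@series_le_cvg _ _ (geometric C z)).
- by move=> n; exact: normr_ge0.
- by move=> n; apply: mulr_ge0 => //; exact: exprn_ge0.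
- exact: du.
- by apply: is_cvg_geometric_series; rewrite ger0_norm.
Qed.

(** The intervals of level [n] are numbered from left to right by [i < 2 ^ n],
    so that the children of the interval [i] are the intervals [i.*2] and
    [i.*2.+1] of level [n.+1]. *)
Fixpoint cantor_left {R : realType} (gamma : R) (n i : nat) : R :=
  if n is m.+1 then
    cantor_left gamma m i./2 + (odd i)%:R * (gamma ^+ m - gamma ^+ m.+1)
  else 1.

Arguments cantor_left : simpl never.

Definition cantor_right {R : realType} (gamma : R) (n i : nat) : R :=
  cantor_left gamma n i + gamma ^+ n.

Definition cantor_itv {R : realType} (gamma : R) (n i : nat) : interval R :=
  `[cantor_left gamma n i, cantor_right gamma n i].

Section CantorIntervals.
Context {R : realType}.
Variable gamma : R.

Local Notation cantor_left := (cantor_left gamma).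
Local Notation cantor_right := (cantor_right gamma).
Local Notation cantor_itv := (cantor_itv gamma).

Lemma cantor_leftS n i :
  cantor_left n.+1 i =
  cantor_left n i./2 + (odd i)%:R * (gamma ^+ n - gamma ^+ n.+1).
Proof. by []. Qed.

Lemma in_cantor_itv n i x :
  (x \in cantor_itv n i) = (cantor_left n i <= x <= cantor_right n i).
Proof. exact: in_itv. Qed.

Lemma cantor_left_double n i : cantor_left n.+1 i.*2 = cantor_left n i.
Proof. by rewrite cantor_leftS odd_double doubleK mul0r addr0. Qed.

Lemma cantor_left_doubleS n i :
  cantor_left n.+1 i.*2.+1 = cantor_right n i - gamma ^+ n.+1.
Proof.
by rewrite cantor_leftS/= odd_double uphalf_double mul1r addrA.
Qed.

Lemma cantor_right_double n i :
  cantor_right n.+1 i.*2 = cantor_left n i + gamma ^+ n.+1.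
Proof. by rewrite /cantor_right cantor_left_double. Qed.

Lemma cantor_right_doubleS n i : cantor_right n.+1 i.*2.+1 = cantor_right n i.
Proof. by rewrite {1}/cantor_right cantor_left_doubleS subrK. Qed.

Lemma cantor_left0 n : cantor_left n 0 = 1.
Proof. by elim: n => // n IHn; rewrite cantor_leftS IHn mul0r addr0. Qed.

Lemma mem_cantor_intervals n (J : R * R) :
  reflect (exists2 i, (i < 2 ^ n)%N & J = (cantor_left n i, cantor_right n i))
          (J \in cantor_intervals gamma n).
Proof.
elim: n J => [|n IHn] J /=.
  by rewrite inE; apply: (iffP eqP) => [->|[i _ ->]//]; exists 0%N.
apply: (iffP flatten_mapP) => [[_ /IHn[i i2 ->]]|[i i2 ->]].
  rewrite !inE expnS mul2n => /predU1P[->|/eqP->].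
  - exists i.*2; first by rewrite ltn_double.
    by rewrite cantor_left_double cantor_right_double.
  - exists i.*2.+1; first by rewrite ltn_Sdouble.
    by rewrite cantor_left_doubleS cantor_right_doubleS.
exists (cantor_left n i./2, cantor_right n i./2).
  by apply/IHn; exists i./2; rewrite // ltn_half_double -mul2n -expnS.
rewrite -(odd_double_half i) half_bit_double; case: (odd i).
- by rewrite cantor_left_doubleS cantor_right_doubleS !inE eqxx orbT.
- by rewrite cantor_left_double cantor_right_double mem_head.
Qed.

Hypothesis gamma_gt0_lt_half : 0 < gamma < 1 / 2.

Lemma cantor_length_gt0 n : 0 < gamma ^+ n.
Proof. by rewrite exprn_gt0//; have /andP[] := gamma_gt0_lt_half. Qed.

Lemma cantor_length_double_lt n : gamma ^+ n.+1 * 2 < gamma ^+ n.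
Proof.
have /andP[_ g1] := gamma_gt0_lt_half.
by rewrite exprS; have := cantor_length_gt0 n; nra.
Qed.

Lemma cantor_left_itv n i : cantor_left n i \in cantor_itv n i.
Proof. by rewrite in_cantor_itv lexx lerDl ltW// cantor_length_gt0. Qed.

Lemma cantor_right_itv n i : cantor_right n i \in cantor_itv n i.
Proof. by rewrite in_cantor_itv lexx lerDl ltW// cantor_length_gt0. Qed.

Lemma cantor_itv_half n i : {subset cantor_itv n.+1 i <= cantor_itv n i./2}.
Proof.
move=> x; rewrite !in_cantor_itv /cantor_right cantor_leftS.
have := cantor_length_gt0 n; have := cantor_length_double_lt n.
by case: (odd i) => /=; lra.
Qed.

Lemma cantor_itv_uniq n i j x : (i < 2 ^ n)%N -> (j < 2 ^ n)%N ->
  x \in cantor_itv n i -> x \in cantor_itv n j -> i = j.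
Proof.
elim: n i j => [[|//] [|//] //|n IHn] i j.
rewrite expnS mul2n -!ltn_half_double => i2 j2 xi xj.
have half_eq : i./2 = j./2 by apply: IHn => //; exact: cantor_itv_half.
suff odd_eq : odd i = odd j.
  by rewrite -(odd_double_half i) half_eq odd_eq odd_double_half.
move: xi xj; rewrite !in_cantor_itv /cantor_right !cantor_leftS half_eq.
by case: (odd i); case: (odd j) => //=; have := cantor_length_double_lt n; lra.
Qed.

Lemma cantor_itv_em n x :
  (exists2 i, (i < 2 ^ n)%N & x \in cantor_itv n i) \/
  (forall i, (i < 2 ^ n)%N -> x \notin cantor_itv n i).
Proof.
have [xI|xN] := pselect (exists2 i, (i < 2 ^ n)%N & x \in cantor_itv n i).
  by left.
by right=> i i2; apply/negP => xi; apply: xN; exists i.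
Qed.

Lemma cantor_left_ge1 n i : 1 <= cantor_left n i.
Proof.
elim: n i => //= n IHn i; rewrite (le_trans (IHn i./2))// lerDl mulr_ge0//.
by have := cantor_length_double_lt n; have := cantor_length_gt0 n.+1; lra.
Qed.

Lemma cantor_right_ge1 n i : 1 <= cantor_right n i.
Proof.
apply: le_trans (cantor_left_ge1 n i) _.
by rewrite lerDl ltW// cantor_length_gt0.
Qed.

Lemma cantor_approxS_in n i x : (i < 2 ^ n)%N -> x \in cantor_itv n i ->
  cantor_approx gamma n.+1 x =
  cantor_step (cantor_approx gamma n) (gamma ^+ n.+1)
    (cantor_left n i, cantor_right n i) x.
Proof.
move=> i2 xi; apply: (@foldr_if_uniq _ _ (fun J : R * R => J.1 <= x <= J.2)
  (fun J => cantor_step (cantor_approx gamma n) (gamma ^+ n.+1) J x)).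
- by apply/mem_cantor_intervals; exists i.
- by rewrite -in_cantor_itv.
- move=> _ /mem_cantor_intervals[j j2 ->]; rewrite -in_cantor_itv => xj.
  by rewrite (cantor_itv_uniq i2 j2 xi xj).
Qed.

Lemma cantor_approxS_notin n x :
  (forall i, (i < 2 ^ n)%N -> x \notin cantor_itv n i) ->
  cantor_approx gamma n.+1 x = cantor_approx gamma n x.
Proof.
move=> xN; apply: (@foldr_if_none _ _ (fun J : R * R => J.1 <= x <= J.2)
  (fun J => cantor_step (cantor_approx gamma n) (gamma ^+ n.+1) J x)).
by move=> _ /mem_cantor_intervals[i i2 ->]; rewrite -in_cantor_itv xN.
Qed.

End CantorIntervals.

Section CantorStep.
Context {R : realType}.
Variables (g : R -> R) (l s t : R).
Hypothesis l_gt0 : 0 < l.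
Hypothesis gap_gt0 : l * 2 < t - s.

Lemma cantor_step_left : cantor_step g l (s, t) s = g s.
Proof. by rewrite /cantor_step lerDl ltW//; field; rewrite gt_eqF. Qed.

Lemma cantor_step_addl : cantor_step g l (s, t) (s + l) = (g s + g t) / 2.
Proof. by rewrite /cantor_step lexx; field; rewrite gt_eqF. Qed.

Lemma cantor_step_subr : cantor_step g l (s, t) (t - l) = (g s + g t) / 2.
Proof.
have gap := gap_gt0.
rewrite /cantor_step ltxx ifF; last by apply/negbTE; rewrite -ltNge; lra.
by field; rewrite gt_eqF.
Qed.

Lemma cantor_step_right : cantor_step g l (s, t) t = g t.
Proof.
have gap := gap_gt0; have l0 := l_gt0.
rewrite /cantor_step leNgt ifF; last by apply/negbTE; rewrite negbK; lra.
rewrite ifF; last by apply/negbTE; rewrite -leNgt; lra.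
by field; rewrite gt_eqF.
Qed.

Lemma cantor_step_nd : g s <= g t ->
  {homo cantor_step g l (s, t) : x y / x <= y}.
Proof.
move=> gst x y xy; rewrite /cantor_step.
have l0 := l_gt0; have gap := gap_gt0; set h := (g s + g t) / 2.
have [sh ht] : g s <= h /\ h <= g t by rewrite /h; lra.
have slope_ge0 (a : R) : 0 <= a -> 0 <= a / l.
  by move=> a0; rewrite divr_ge0// ltW.
have slope_nd (a c : R) : a <= c -> a / l <= c / l.
  by rewrite ler_pM2r// invr_gt0.
have [xs|xs] := leP x (s + l); have [ys|ys] := leP y (s + l); try by lra.
- by rewrite lerD2l ler_wpM2l ?subr_ge0// slope_nd// lerD2r.
- have xh : g s + (h - g s) * ((x - s) / l) <= h.
    have : (x - s) / l <= 1 by rewrite ler_pdivrMr// mul1r; lra.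
    by nra.
  case: ltP => yt //.
  by rewrite (le_trans xh)// lerDl mulr_ge0 ?subr_ge0// slope_ge0// subr_ge0.
- case: ltP => xt; case: ltP => yt //.
  + by rewrite lerDl mulr_ge0 ?subr_ge0// slope_ge0// subr_ge0.
  + by lra.
  + by rewrite lerD2l ler_wpM2l ?subr_ge0// slope_nd// lerD2r.
Qed.

End CantorStep.

Section CantorFunction.
Context {R : realType}.
Variable gamma : R.
Hypothesis gamma_gt0_lt_half : 0 < gamma < 1 / 2.

Local Notation cantor_left := (cantor_left gamma).
Local Notation cantor_right := (cantor_right gamma).
Local Notation cantor_itv := (cantor_itv gamma).
Local Notation approx := (cantor_approx gamma).

Let length_gt0 n : 0 < gamma ^+ n.
Proof. exact: cantor_length_gt0. Qed.

Let gap_gt0 n i : gamma ^+ n.+1 * 2 < cantor_right n i - cantor_left n i.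
Proof. by rewrite addrC addKr cantor_length_double_lt. Qed.

Lemma cantor_approxS_left n i : (i < 2 ^ n)%N ->
  approx n.+1 (cantor_left n i) = approx n (cantor_left n i).
Proof.
move=> i2; rewrite (@cantor_approxS_in _ _ _ n i) ?cantor_left_itv//.
exact: cantor_step_left.
Qed.

Lemma cantor_approxS_right n i : (i < 2 ^ n)%N ->
  approx n.+1 (cantor_right n i) = approx n (cantor_right n i).
Proof.
move=> i2; rewrite (@cantor_approxS_in _ _ _ n i) ?cantor_right_itv//.
exact: cantor_step_right.
Qed.

Lemma le_cantor_approxS n z x : {homo approx n : x y / x <= y} -> z <= x ->
  (forall i, (i < 2 ^ n)%N ->
    x \in cantor_itv n i -> z \notin cantor_itv n i) ->
  approx n z <= approx n.+1 x.
Proof.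
move=> nd zx zN; have [[i i2 xi]|xN] := cantor_itv_em gamma n x; last first.
  by rewrite cantor_approxS_notin//; exact: nd.
have := xi; rewrite in_cantor_itv => /andP[lx xr].
have zl : z <= cantor_left n i.
  by have := zN i i2 xi; rewrite in_cantor_itv; lra.
apply: le_trans (nd _ _ zl) _; rewrite -cantor_approxS_left//.
rewrite !(@cantor_approxS_in _ _ _ n i) ?cantor_left_itv//.
by apply: cantor_step_nd => //; apply: nd; exact: le_trans lx xr.
Qed.

Lemma cantor_approx_nd n : {homo approx n : x y / x <= y}.
Proof.
elim: n => [|n IHn] x y xy; first by rewrite /= lerD2r.
have [[i i2 xi]|xN] := cantor_itv_em gamma n x; last first.
  rewrite cantor_approxS_notin//; apply: le_cantor_approxS => // i i2 _.
  exact: xN.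
have mono : {in cantor_itv n i &, {homo approx n.+1 : x y / x <= y}}.
  move=> u v ui vi uv; rewrite !(@cantor_approxS_in _ _ _ n i)//.
  apply: cantor_step_nd => //; apply: IHn.
  by have := length_gt0 n; rewrite /cantor_right; lra.
have [yi|yNi] := boolP (y \in cantor_itv n i); first exact: mono.
(* Go through the right endpoint of the interval of [x], where the two
   approximations agree. *)
have := xi; rewrite in_cantor_itv => /andP[lx xr].
apply: le_trans (mono _ _ xi (cantor_right_itv _ n i) xr) _ => //.
rewrite cantor_approxS_right//; apply: le_cantor_approxS => //.
  by move: yNi; rewrite in_cantor_itv; lra.
move=> j j2 yj; apply: contra yNi => rj.
have ri := cantor_right_itv gamma_gt0_lt_half n i.
by rewrite (cantor_itv_uniq gamma_gt0_lt_half i2 j2 ri rj).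
Qed.

Lemma cantor_approx_endpoints n i : (i < 2 ^ n)%N ->
  approx n (cantor_left n i) = i%:R / 2 ^+ n /\
  approx n (cantor_right n i) = i.+1%:R / 2 ^+ n.
Proof.
elim: n i => [[|//] _|n IHn i].
  by rewrite /cantor_right cantor_left0 !expr0; split=> /=; lra.
rewrite -(odd_double_half i) expnS mul2n; move: i./2 => k.
case: (odd i); rewrite ?add1n ?add0n ?ltn_Sdouble ?ltn_double => k2;
  have [fl fr] := IHn k k2.
- rewrite cantor_right_doubleS cantor_approxS_right// fr cantor_left_doubleS.
  rewrite (@cantor_approxS_in _ _ _ n k)//; last first.
    rewrite in_cantor_itv; have := gap_gt0 n k; have := length_gt0 n.+1; lra.
  by rewrite cantor_step_subr// fl fr dyadic_doubleS -doubleS dyadic_double.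
- rewrite cantor_left_double cantor_approxS_left// fl cantor_right_double.
  rewrite (@cantor_approxS_in _ _ _ n k)//; last first.
    rewrite in_cantor_itv; have := gap_gt0 n k; have := length_gt0 n.+1; lra.
  by rewrite cantor_step_addl// fl fr dyadic_doubleS dyadic_double.
Qed.

Lemma cantor_approx_dist n x :
  `|approx n.+1 x - approx n x| <= 2^-1 ^+ n.
Proof.
have [[i i2 xi]|xN] := cantor_itv_em gamma n x; last first.
  by rewrite cantor_approxS_notin// subrr normr0 exprn_ge0.
have := xi; rewrite in_cantor_itv => /andP[lx xr].
have [fl fr] := cantor_approx_endpoints i2.
have := cantor_approx_nd n lx; have := cantor_approx_nd n xr.
have := cantor_approx_nd n.+1 lx; have := cantor_approx_nd n.+1 xr.
rewrite cantor_approxS_left// cantor_approxS_right// fl fr -natr1 mulrDl.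
by rewrite exprVn ler_norml; lra.
Qed.

Lemma cantor_approx_cvg x : cvgn (fun n => approx n x).
Proof.
apply: (@cvg_geometric_increment _ _ _ 1 2^-1) => // [|n]; first by lra.
by rewrite mul1r; exact: cantor_approx_dist.
Qed.

Lemma cantor_approxD_endpoints n i k : (i < 2 ^ n)%N ->
  approx (n + k) (cantor_left n i) = i%:R / 2 ^+ n /\
  approx (n + k) (cantor_right n i) = i.+1%:R / 2 ^+ n.
Proof.
elim: k n i => [|k IHk] n i i2.
  by rewrite addn0; exact: cantor_approx_endpoints.
rewrite -addSnnS -cantor_left_double -cantor_right_doubleS.
rewrite -(dyadic_double _ n i) -(dyadic_double _ n i.+1) doubleS.
have i2S : (i.*2.+1 < 2 ^ n.+1)%N by rewrite expnS mul2n ltn_Sdouble.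
split; first by have [] := IHk n.+1 i.*2 (ltnW i2S).
by have [] := IHk n.+1 i.*2.+1 i2S.
Qed.

Lemma lim_cantor_approx_left n i : (i < 2 ^ n)%N ->
  limn (fun k => approx k (cantor_left n i)) = i%:R / 2 ^+ n.
Proof.
move=> i2; apply: lim_near_cst => //; exists n => // k /= nk.
by rewrite -(subnKC nk); have [] := cantor_approxD_endpoints (k - n) i2.
Qed.

Lemma lim_cantor_approx_right n i : (i < 2 ^ n)%N ->
  limn (fun k => approx k (cantor_right n i)) = i.+1%:R / 2 ^+ n.
Proof.
move=> i2; apply: lim_near_cst => //; exists n => // k /= nk.
by rewrite -(subnKC nk); have [] := cantor_approxD_endpoints (k - n) i2.
Qed.

Lemma lim_cantor_approx_nd :
  {homo (fun x => limn (fun n => approx n x)) : x y / x <= y}.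
Proof.
move=> x y xy; apply: ler_lim; [exact: cantor_approx_cvg..|].
by apply: nearW => n; exact: cantor_approx_nd.
Qed.

Lemma cantor_fun_nd : {homo cantor_fun gamma : x y / x <= y}.
Proof.
pose F x := limn (fun n => approx n x).
have F1 : F 1 = 0.
  by rewrite /F -(cantor_left0 gamma 0) lim_cantor_approx_left// mul0r.
have F2 : F 2 = 1.
  have <- : cantor_right 0 0 = 2.
    by rewrite /cantor_right cantor_left0 expr0; lra.
  by rewrite /F lim_cantor_approx_right// expr0; lra.
have Fnd := lim_cantor_approx_nd; move=> x y xy; rewrite /cantor_fun -!/(F _).
have [x1|x1] := ltP x 1; have [y1|y1] := ltP y 1; have [x2|x2] := ltP 2 x;
  have [y2|y2] := ltP 2 y; try lra.
- by rewrite -F1; exact: Fnd.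
- by rewrite -F2; exact: Fnd.
- exact: Fnd.
Qed.

Lemma cantor_fun_eq_lim n i x : (i < 2 ^ n)%N -> x \in cantor_itv n i ->
  cantor_fun gamma x = limn (fun n => approx n x).
Proof.
elim: n i => [[|//] _|n IHn i i2 /cantor_itv_half xi]; last first.
  by apply: IHn (xi _) => //; rewrite ltn_half_double -mul2n -expnS.
rewrite in_cantor_itv /cantor_right cantor_left0 expr0 => x12.
by rewrite /cantor_fun !ifF//; lra.
Qed.

Lemma cantor_fun_left n i : (i < 2 ^ n)%N ->
  cantor_fun gamma (cantor_left n i) = i%:R / 2 ^+ n.
Proof.
move=> i2; rewrite (cantor_fun_eq_lim i2) ?cantor_left_itv//.
exact: lim_cantor_approx_left.
Qed.

Lemma cantor_fun_right n i : (i < 2 ^ n)%N ->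
  cantor_fun gamma (cantor_right n i) = i.+1%:R / 2 ^+ n.
Proof.
move=> i2; rewrite (cantor_fun_eq_lim i2) ?cantor_right_itv//.
exact: lim_cantor_approx_right.
Qed.

End CantorFunction.

Lemma nested_itvcc_point (R : realType) (u v : R ^nat) :
  nondecreasing_seq u -> nonincreasing_seq v -> (forall n, u n <= v n) ->
  exists t, forall n, t \in `[u n, v n].
Proof.
move=> u_nd v_ni uv; have uv2 n k : u n <= v k.
  apply: le_trans (u_nd _ _ (leq_maxl n k)) _.
  by apply: le_trans (uv _) _; apply: v_ni; exact: leq_maxr.
exists (sup (range u)) => n; rewrite in_itv/=; apply/andP; split.
  by apply: ub_le_sup; [exists (v 0%N) => _ [k _ <-]; exact: uv2|exists n].
by apply: ge_sup => [|_ [k _ <-]]; [exists (u 0%N), 0%N|exact: uv2].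
Qed.

Lemma isolated_zero_of_nested (R : realType) (g : R -> R) (u v : R ^nat) t :
  0 <= u 0%N -> t \in `]u 0%N, v 0%N[ -> g t = 0 ->
  (forall n, t \in `[u n, v n]) -> v n - u n @[n --> \oo] --> 0 ->
  (forall n s, s \in `[u n, v n] -> g s = 0 -> s \in `[u n.+1, v n.+1]) ->
  isolated (zeros g) t.
Proof.
move=> u0 t0 gt tuv vu0 trap; have := t0; rewrite in_itv/= => /andP[ut tv].
have zero_t : zeros g t by split; first exact: le_lt_trans ut.
split; first by rewrite inE.
exists `]u 0%N, v 0%N[%classic; first exact: near_in_itvoo.
apply/seteqP; split => [s|_ ->]; last by split.
case=> s0 [_ gs]; have suv n : s \in `[u n, v n].
  by elim: n => [|n IHn]; [exact: subset_itv_oo_cc|exact: trap].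
apply/eqP; rewrite -subr_eq0 -normr_eq0 eq_le normr_ge0 andbT.
apply: (ler_cvg_to (cvg_cst _) vu0); apply: nearW => n.
by move: (suv n) (tuv n); rewrite !in_itv/= ler_norml; lra.
Qed.

Fixpoint sign_change_index {R : realType} (g : R -> R) (gamma : R)
    (m p : nat) : nat :=
  if p is q.+1 then
    let i := sign_change_index g gamma m q in
    if g (cantor_right gamma (m + q.+1) i.*2) < 0 then i.*2 else i.*2.+1
  else 0%N.

Section IsolatedZero.
Context {R : realType}.
Variables (b : R -> R) (gamma : R) (m : nat) (delta : R ^nat).
Hypothesis gamma_gt0_lt_half : 0 < gamma < 1 / 2.

Local Notation node_left p i := (cantor_left gamma (m + p) i).
Local Notation node_right p i := (cantor_right gamma (m + p) i).
Local Notation node p i := (cantor_itv gamma (m + p) i).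
Let g t := b t - cantor_fun gamma t.

Hypothesis oscillation : forall p i, (i < 2 ^ p)%N ->
  {in node p i &, forall s t, `|b s - b t| <= delta p}.
Hypothesis far_left : forall p i, (i < 2 ^ p.+1)%N ->
  delta p < `|g (node_left p.+1 i)|.
Hypothesis far_right : forall p i, (i < 2 ^ p.+1)%N ->
  delta p < `|g (node_right p.+1 i)|.
Hypothesis delta_cvg0 : delta n @[n --> \oo] --> 0.

Let ltn_level p i : (i < 2 ^ p)%N -> (i < 2 ^ (m + p))%N.
Proof. by move=> /leq_trans; apply; rewrite leq_exp2l// leq_addl. Qed.

Let node_half p i : {subset node p.+1 i <= node p i./2}.
Proof. by rewrite addnS; exact: cantor_itv_half. Qed.

Let node_left_in p i : node_left p i \in node p i.
Proof. exact: cantor_left_itv. Qed.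

Let node_right_in p i : node_right p i \in node p i.
Proof. exact: cantor_right_itv. Qed.

Let cantor_fun_mono : {homo cantor_fun gamma : x y / x <= y}.
Proof. exact: cantor_fun_nd. Qed.

Lemma sign_change_child p i : (i < 2 ^ p)%N ->
  g (node_right p.+1 i.*2) < 0 \/ 0 < g (node_left p.+1 i.*2.+1).
Proof.
move=> i2.
have i2r : (i.*2.+1 < 2 ^ p.+1)%N by rewrite expnS mul2n ltn_Sdouble.
have i2l := ltnW i2r.
have far_l := far_left i2r; have far_r := far_right i2l.
have osc : `|b (node_right p.+1 i.*2) - b (node_left p.+1 i.*2.+1)| <= delta p.
  apply: (oscillation i2).
  - by rewrite -[i in node _ i]doubleK node_half.
  - by rewrite -[i in node _ i](half_bit_double i true) node_half.
have feq : cantor_fun gamma (node_right p.+1 i.*2) =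
    cantor_fun gamma (node_left p.+1 i.*2.+1).
  by rewrite cantor_fun_right ?cantor_fun_left// ltn_level.
have [?|gr] := ltP (g (node_right p.+1 i.*2)) 0; [by left|right].
rewrite ltNge; apply/negP => gl; move: osc far_l far_r.
rewrite (ger0_norm gr) (ler0_norm gl) ler_norml.
by move: gl gr; rewrite /g feq; lra.
Qed.

Lemma zero_in_sign_change_child p i s : (i < 2 ^ p.+1)%N ->
  0 < g (node_left p.+1 i) -> g (node_right p.+1 i) < 0 ->
  s \in node p i./2 -> g s = 0 -> s \in node p.+1 i.
Proof.
move=> i2 gl gr si gs.
have i2h : (i./2 < 2 ^ p)%N by rewrite ltn_half_double -mul2n -expnS.
have oscl : `|b s - b (node_left p.+1 i)| <= delta p.
  by apply: (oscillation i2h) => //; exact: node_half.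
have oscr : `|b s - b (node_right p.+1 i)| <= delta p.
  by apply: (oscillation i2h) => //; exact: node_half.
have far_l := far_left i2; have far_r := far_right i2.
move: far_l far_r oscl oscr; rewrite (gtr0_norm gl) (ltr0_norm gr) !ler_norml.
move: gs; rewrite in_cantor_itv /g => gs far_l far_r oscl oscr.
by apply/andP; split; rewrite leNgt; apply/negP => /ltW/cantor_fun_mono; lra.
Qed.

Hypothesis g_left_gt0 : 0 < g (node_left 0 0).
Hypothesis g_right_lt0 : g (node_right 0 0) < 0.

Local Notation idx := (sign_change_index g gamma m).

Lemma sign_change_indexP p :
  [/\ (idx p < 2 ^ p)%N, 0 < g (node_left p (idx p)) &
      g (node_right p (idx p)) < 0].
Proof.
elim: p => [|p [i2 gl gr]] //=.
have i2r : ((idx p).*2.+1 < 2 ^ p.+1)%N by rewrite expnS mul2n ltn_Sdouble.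
case: ifPn => [gr'|grN].
  by split; [exact: ltnW|rewrite addnS cantor_left_double|].
split=> //; last by rewrite addnS cantor_right_doubleS.
by have [gr'|//] := sign_change_child i2; rewrite gr' in grN.
Qed.

Lemma sign_change_index_half p : (idx p.+1)./2 = idx p.
Proof. by rewrite /=; case: ifP => _; rewrite ?doubleK //= uphalf_double. Qed.

Lemma sign_change_nodeS p : {subset node p.+1 (idx p.+1) <= node p (idx p)}.
Proof. by move=> s /node_half; rewrite sign_change_index_half. Qed.

Lemma zero_of_nested_sign_change t :
  (forall p, t \in node p (idx p)) -> g t = 0.
Proof.
move=> tI; have g_small p : `|g t| <= delta p + 2^-1 ^+ p.
  have [i2 gl gr] := sign_change_indexP p.
  have oscl := oscillation i2 (tI p) (node_left_in p (idx p)).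
  have oscr := oscillation i2 (tI p) (node_right_in p (idx p)).
  have := tI p; rewrite in_cantor_itv.
  move=> /andP[/cantor_fun_mono + /cantor_fun_mono].
  move: gl gr oscl oscr; rewrite /g !ler_norml.
  rewrite cantor_fun_left ?cantor_fun_right ?ltn_level//.
  rewrite -(natr1 (idx p)) mulrDl mul1r -exprVn.
  have : (2^-1 : R) ^+ (m + p) <= 2^-1 ^+ p.
    by rewrite exprD ler_piMl ?exprn_ge0 ?exprn_ile1//; lra.
  by lra.
have : delta p + 2^-1 ^+ p @[p --> \oo] --> 0 + 0.
  apply: cvgD; first exact: delta_cvg0.
  by apply: cvg_expr; rewrite ger0_norm; lra.
rewrite addr0 => lim0; apply/eqP; rewrite -normr_eq0 eq_le normr_ge0 andbT.
by apply: (ler_cvg_to (cvg_cst _) lim0); exact: nearW.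
Qed.

Lemma isolated_zero_of_path : isolated (zeros g) !=set0.
Proof.
have [t tI] : exists t, forall p, t \in node p (idx p).
  apply: nested_itvcc_point => [||p].
  - apply/nondecreasing_seqP => p.
    have := sign_change_nodeS (node_left_in p.+1 (idx p.+1)).
    by rewrite in_cantor_itv => /andP[].
  - apply/nonincreasing_seqP => p.
    have := sign_change_nodeS (node_right_in p.+1 (idx p.+1)).
    by rewrite in_cantor_itv => /andP[].
  - have := node_left_in p (idx p).
    by rewrite in_cantor_itv => /andP[].
have gt_eq0 := zero_of_nested_sign_change tI.
exists t; apply: (@isolated_zero_of_nested _ _ (fun p => node_left p (idx p))
  (fun p => node_right p (idx p))) => //.
- by rewrite (le_trans ler01)// cantor_left_ge1.
- have := tI 0%N; rewrite in_cantor_itv in_itv/= !le_eqVlt => /andP[le_t t_le].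
  apply/andP; split.
  + case/predU1P: le_t => // t_eq.
    by move: g_left_gt0; rewrite t_eq gt_eq0 !ltxx.
  + case/predU1P: t_le => // t_eq.
    by move: g_right_lt0; rewrite -t_eq gt_eq0 !ltxx.
- rewrite (_ : (fun p => _) = geometric (gamma ^+ m) gamma); last first.
    by apply/funext => p; rewrite /cantor_right addrC addKr exprD.
  have /andP[gamma0 gamma_half] := gamma_gt0_lt_half.
  by apply: cvg_geometric; rewrite ger0_norm; lra.
- move=> p s si gs; have [i2 gl gr] := sign_change_indexP p.+1.
  apply: zero_in_sign_change_child => //.
  by rewrite sign_change_index_half.
Qed.

End IsolatedZero.

Lemma cvg_truncn_dyadic (R : realType) (x : R) : 0 <= x ->
  (Num.truncn (x * 2 ^+ n))%:R / 2 ^+ n @[n --> \oo] --> x.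
Proof.
move=> x0; apply: (@squeeze_cvgr _ _ _ _ (fun n => x - 2^-1 ^+ n) (cst x)).
- apply: nearW => n.
  have pow_gt0 : 0 < 2 ^+ n :> R by rewrite exprn_gt0.
  have /andP[le_x gt_x] := truncn_itv (mulr_ge0 x0 (ltW pow_gt0)).
  rewrite ler_pdivrMr// le_x andbT ler_pdivlMr// mulrBl exprVn mulVf ?gt_eqF//.
  by rewrite lerBlDr natr1 ltW.
- have : x - 2^-1 ^+ n @[n --> \oo] --> x - 0.
    apply: cvgB; first exact: cvg_cst.
    by apply: cvg_expr; rewrite ger0_norm; lra.
  by rewrite subr0.
- exact: cvg_cst.
Qed.

Lemma continuous_at_gt0 (R : realType) (b : R -> R) t :
  {within `[0, +oo[, continuous b} -> 0 < t -> {for t, continuous b}.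
Proof.
move=> cb t0; have : {within `]0, +oo[, continuous b}.
  apply: continuous_subspaceW cb => x /=.
  by rewrite !in_itv/= !andbT; exact: ltW.
by rewrite continuous_open_subspace//; apply; rewrite inE/= in_itv/= andbT.
Qed.

Section DyadicChaining.
Context {R : realType} {V : normedModType R}.
Variables (h : R -> V) (c rho : R).
Hypothesis increment_le : forall j k, (k < 2 ^ j)%N ->
  `|h (k.+1%:R / 2 ^+ j) - h (k%:R / 2 ^+ j)| <= c * rho ^+ j.
Hypothesis rho_gt0_lt1 : 0 < rho < 1.

Let c_ge0 : 0 <= c.
Proof.
by have := @increment_le 0%N 0%N isT; rewrite expr0 mulr1; exact: le_trans.
Qed.

Lemma dyadic_point_chaining j k : (k <= 2 ^ j)%N ->
  `|h (k%:R / 2 ^+ j) - h 0| <= series (geometric c rho) j.+1.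
Proof.
have /andP[rho0 _] := rho_gt0_lt1.
elim: j k => [|j IHj] k.
  rewrite seriesEnat /= big_nat1 expr0 mulr1; case: k => [|[|//]] _.
    by rewrite mul0r subrr normr0.
  by have := @increment_le 0%N 0%N isT; rewrite mul0r !expr0 mulr1.
rewrite -(odd_double_half k) expnS mul2n; move: k./2 => i.
rewrite seriesS /=.
case: (odd k); rewrite ?add1n ?add0n ?ltn_double ?leq_double => i2.
  rewrite -[X in `|X|](subrKA (h (i.*2%:R / 2 ^+ j.+1))).
  apply: le_trans (ler_normD _ _) _; apply: lerD.
    by apply: increment_le; rewrite expnS mul2n ltn_double.
  by rewrite dyadic_double; apply: IHj; exact: ltnW.
rewrite dyadic_double (le_trans (IHj _ i2))// lerDr mulr_ge0// exprn_ge0//.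
exact: ltW.
Qed.

Lemma dyadic_chaining t : 0 <= t <= 1 -> {for t, continuous h} ->
  `|h t - h 0| <= c / (1 - rho).
Proof.
have /andP[rho0 rho1] := rho_gt0_lt1; move=> /andP[t0 t1] ht.
pose d n : R := (Num.truncn (t * 2 ^+ n))%:R / 2 ^+ n.
have hd : `|h (d n) - h 0| @[n --> \oo] --> `|h t - h 0|.
  apply: cvg_norm; apply: cvgB; last exact: cvg_cst.
  exact: (cvg_comp _ _ (cvg_truncn_dyadic t0) ht).
apply: (ler_cvg_to hd (cvg_cst (c / (1 - rho)))); apply: nearW => n.
apply: le_trans (geometric_le_lim n.+1 c_ge0 rho0 _); last by rewrite gtr0_norm.
apply: dyadic_point_chaining.
rewrite -(ler_nat R) natrX; apply: (@le_trans _ _ (t * 2 ^+ n)).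
  by rewrite truncn_le mulr_ge0// exprn_ge0.
by rewrite ler_piMl// exprn_ge0.
Qed.

End DyadicChaining.

Lemma expRN_le_fact (R : realType) (y : R) q :
  0 < y -> expR (- y) <= q`!%:R / y ^+ q.
Proof.
move=> y0; case: q => [|q].
  by rewrite expr0 divr1 -expR0 ler_expR oppr_le0 ltW.
rewrite expRN -[leRHS]invf_div.
rewrite lef_pV2 ?posrE ?expR_gt0 ?divr_gt0 ?exprn_gt0 ?ltr0n ?fact_gt0//.
by apply: le_trans (expR_ge1Dxn q (ltW y0)); rewrite lerDr.
Qed.

Section NormalProb.
Context {R : realType}.
Implicit Types (m s c u x : R) (A : set R).

Let measurable_pdf m s A : measurable_fun A (fun x => (normal_pdf m s x)%:E).
Proof.
apply: measurable_funTS; apply/measurable_EFinP.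
exact: measurable_normal_pdf.
Qed.

Let pdf_ge0 m s x : (0 <= (normal_pdf m s x)%:E)%E.
Proof. by rewrite lee_fin normal_pdf_ge0. Qed.

Lemma normal_prob_le_pdf m s m' s' c A : measurable A -> 0 <= c ->
  {in A, forall x, normal_pdf m s x <= c * normal_pdf m' s' x} ->
  (normal_prob m s A <= c%:E * normal_prob m' s' A)%E.
Proof.
move=> mA c0 le_pdf; rewrite /normal_prob.
rewrite -ge0_integralZl_EFin//; last exact: measurable_pdf.
apply: ge0_le_integral => //.
- exact: measurable_pdf.
- by apply: measurable_funeM; exact: measurable_pdf.
- by move=> x Ax; rewrite -EFinM lee_fin le_pdf// inE.
Qed.

Lemma normal_prob_le_peak m s A : measurable A -> s != 0 ->
  (normal_prob m s A <= (normal_peak s)%:E * lebesgue_measure A)%E.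
Proof.
move=> mA s0; rewrite -integral_cst//; apply: ge0_le_integral => //.
  exact: measurable_pdf.
by move=> x _; rewrite lee_fin normal_pdf_ub.
Qed.

Lemma normal_prob_ge_cst m s c A : measurable A -> 0 <= c ->
  {in A, forall x, c <= normal_pdf m s x} ->
  (c%:E * lebesgue_measure A <= normal_prob m s A)%E.
Proof.
move=> mA c0 le_pdf; rewrite -integral_cst//; apply: ge0_le_integral => //.
  exact: measurable_pdf.
by move=> x Ax; rewrite lee_fin le_pdf// inE.
Qed.

Lemma measurable_norm_gt u : measurable [set x : R | u < `|x|].
Proof.
rewrite (_ : mkset _ = (fun x : R => `|x|) @^-1` `]u, +oo[%classic).
  by rewrite -[X in measurable X]setTI; apply: (@normr_measurable R setT).
by apply/seteqP; split => x /=; rewrite in_itv/= andbT.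
Qed.

Lemma normal_peak_double s : 0 < s -> normal_peak s = 2 * normal_peak (2 * s).
Proof.
move=> s0; rewrite /normal_peak.
have -> : (2 * s) ^+ 2 * pi *+ 2 = 2 ^+ 2 * (s ^+ 2 * pi *+ 2) by ring.
by rewrite [in RHS]sqrtrM// sqrtr_sqr ger0_norm// invfM mulrA divff// mul1r.
Qed.

(* Three quarters of the Gaussian exponent are traded for a constant; what
   remains is the density of a normal law of twice the standard deviation. *)
Lemma normal_prob_norm_gt s u : 0 < s -> 0 <= u ->
  (normal_prob 0 s [set x | (u < `|x|)%R] <=
    (2 * expR (- (3 / 8 * (u / s) ^+ 2)))%:E)%E.
Proof.
move=> s0 u0; set c := 2 * _; have c0 : 0 <= c by rewrite mulr_ge0// expR_ge0.
have mA := measurable_norm_gt u.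
apply: (@le_trans _ _ (c%:E * normal_prob 0 (2 * s) [set x | (u < `|x|)%R])%E).
  apply: normal_prob_le_pdf => // x; rewrite inE/= => ux.
  rewrite !normal_pdfE ?gt_eqF ?mulr_gt0// normal_peak_double//.
  rewrite -mulrA /c -[leRHS]mulrA ler_pM2l// mulrCA.
  rewrite ler_wpM2l ?normal_peak_ge0//.
  rewrite /normal_fun -expRD ler_expR !subr0.
  have -> : - x ^+ 2 / (s ^+ 2 *+ 2) =
      - (3 / 8 * (x / s) ^+ 2) + - x ^+ 2 / ((2 * s) ^+ 2 *+ 2).
    by field; rewrite gt_eqF.
  rewrite lerD2r lerN2 ler_pM2l// !expr_div_n ler_pM2r ?invr_gt0 ?exprn_gt0//.
  by rewrite -(real_normK (num_real x)) lerXn2r ?nnegrE// ltW.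
by rewrite -[leRHS]mule1; apply: lee_wpmul2l => //; exact: probability_le1.
Qed.

Lemma normal_prob_norm_gt_le_fact s u q : 0 < s -> 0 < u ->
  (normal_prob 0 s [set x | (u < `|x|)%R] <=
    (2 * (q`!%:R * (4 * s ^+ 2 / u ^+ 2) ^+ q))%:E)%E.
Proof.
move=> s0 u0; apply: le_trans (normal_prob_norm_gt s0 (ltW u0)) _.
rewrite lee_fin ler_pM2l//.
have us0 : 0 < (u / s) ^+ 2 / 4 by rewrite divr_gt0// exprn_gt0// divr_gt0.
have -> : 4 * s ^+ 2 / u ^+ 2 = ((u / s) ^+ 2 / 4)^-1.
  by field; rewrite !gt_eqF.
rewrite exprVn.
apply: le_trans (expRN_le_fact q us0); rewrite ler_expR lerN2; lra.
Qed.

Lemma normal_peak_le1 s : 1 <= s -> normal_peak s <= 1.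
Proof.
move=> s1; have : 1 <= s ^+ 2 * pi *+ 2 by have := pi_ge2 R; nra.
move=> var1; rewrite invf_le1 ?sqrtr_gt0; last by lra.
by rewrite -[leLHS]sqrtr1 ler_sqrt//; lra.
Qed.

Lemma normal_prob_itvcc_le m s u v : 1 <= s -> u <= v ->
  (normal_prob m s `[u, v]%classic <= (v - u)%:E)%E.
Proof.
move=> s1 uv; apply: le_trans (normal_prob_le_peak _ _ _) _ => //.
  by rewrite gt_eqF//; lra.
rewrite lebesgue_measure_itv/= lte_fin lt_neqAle uv andbT.
case: eqP => [->|_] /=; first by rewrite mule0 lee_fin subrr.
by rewrite -EFinM lee_fin ler_piMl ?subr_ge0// normal_peak_le1.
Qed.

Lemma normal_prob_itvoo_ge s c u : 0 < s -> 0 < c <= u ->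
  ((normal_pdf 0 s u * c)%:E <= normal_prob 0 s `]0%R, c[%classic)%E.
Proof.
move=> s0 /andP[c0 cu].
have -> : (normal_pdf 0 s u * c)%:E =
    ((normal_pdf 0 s u)%:E * lebesgue_measure (`]0%R, c[%classic : set R))%E.
  by rewrite lebesgue_measure_itv/= lte_fin c0 sube0.
apply: normal_prob_ge_cst => //; first exact: normal_pdf_ge0.
move=> x; rewrite inE/= in_itv/= => /andP[x0 xc].
rewrite !normal_pdfE ?gt_eqF// ler_wpM2l ?normal_peak_ge0// ler_expR !subr0.
rewrite ler_pM2r ?invr_gt0 ?pmulrn_lgt0 ?exprn_gt0// lerN2.
by rewrite lerXn2r ?nnegrE; lra.
Qed.

End NormalProb.

Lemma measurable_bigcup_tree (d : measure_display) (T : measurableType d)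
    (A : nat -> nat -> set T) r :
  (forall n k, measurable (A n k)) ->
  measurable (\bigcup_n \bigcup_(k < r ^ n) A n k).
Proof.
move=> mA; apply: bigcup_measurable => n _.
by rewrite bigcup_mkord; apply: bigsetU_measurable.
Qed.

Lemma measure_bigcup_tree_le (d : measure_display) (T : measurableType d)
    (R : realType) (mu : {measure set T -> \bar R})
    (A : nat -> nat -> set T) r (c z : R) :
  (0 < r)%N -> 0 <= c -> 0 < z -> r%:R * z < 1 ->
  (forall n k, measurable (A n k)) ->
  (forall n k, (k < r ^ n)%N -> (mu (A n k) <= (c * z ^+ n)%:E)%E) ->
  (mu (\bigcup_n \bigcup_(k < r ^ n) A n k) <= (c / (1 - r%:R * z))%:E)%E.
Proof.
move=> r0 c0 z0 rz1 mA Ale; have rz0 : 0 < r%:R * z by rewrite mulr_gt0// ltr0n.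
have mU n : measurable (\bigcup_(k < r ^ n) A n k).
  by rewrite bigcup_mkord; apply: bigsetU_measurable.
have level n : (mu (\bigcup_(k < r ^ n) A n k) <= (c * (r%:R * z) ^+ n)%:E)%E.
  rewrite bigcup_mkord; apply: le_trans (Boole_inequality mu _) _ => //.
  apply: (@le_trans _ _ (\sum_(i < r ^ n) (c * z ^+ n)%:E)%E).
    by apply: lee_sum => i _; exact: Ale.
  rewrite sumEFin lee_fin sumr_const card_ord -[leLHS]mulr_natl natrX exprMn.
  by rewrite mulrCA mulrA.
apply: le_trans (generalized_Boole_inequality mu mU _) _.
  exact: measurable_bigcup_tree.
apply: lime_le; first by apply: is_cvg_nneseries => n _ _; exact: measure_ge0.
apply: nearW => N; apply: le_trans (lee_sum _ (fun n _ => level n)) _.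
rewrite sumEFin lee_fin; apply: le_trans (geometric_le_lim N c0 rz0 _).
  by rewrite seriesEnat.
by rewrite gtr0_norm.
Qed.

Lemma with_positive_probabilityD (d : measure_display) (T : measurableType d)
    (R : realType) (P : probability T R) (A F S : set T) :
  measurable A -> measurable F -> (P F < P A)%E ->
  {ae P, forall w, A w -> ~ F w -> S w} -> with_positive_probability P S.
Proof.
move=> mA mF PFA [N [mN PN0 subN]].
have mFN : measurable (F `|` N) by exact: measurableU.
have mE : measurable (A `\` (F `|` N)) by exact: measurableD.
exists (A `\` (F `|` N)); split=> // [w [Aw /not_orP[Fw Nw]]|].
  by apply: contrapT => Sw; apply: Nw; apply: subN => /(_ Aw Fw).
rewrite lt0e measure_ge0 andbT; apply/eqP => PE0.
have : (P A <= P F)%E; last by rewrite leNgt PFA.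
have subA : A `<=` (A `\` (F `|` N)) `|` (F `|` N).
  by move=> w Aw; have [FNw|FNw] := pselect ((F `|` N) w); [right|left].
apply: le_trans (le_measure P _ _ subA) _; rewrite ?inE//.
  exact: measurableU.
apply: le_trans (measureU2 _ mE mFN) _; rewrite [X in (X + _)%E]PE0 add0e.
by apply: le_trans (measureU2 _ mF mN) _; rewrite [X in (_ + X)%E]PN0 adde0.
Qed.

Section Brownian.
Context {d : measure_display} {T : measurableType d} {R : realType}.
Context {P : probability T R}.
Variable B : R -> {RV P >-> R}.

Definition dyadic_jumps (a l c rho : R) : set T :=
  \bigcup_j \bigcup_(k < 2 ^ j) [set w | c * rho ^+ j <
    `|B (a + l * (k.+1%:R / 2 ^+ j)) w - B (a + l * (k%:R / 2 ^+ j)) w|].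

Definition near_value (t v r : R) : set T :=
  [set w | B t w - B 0 w \in `[v - r, v + r]].

(** Off this event, [B] oscillates by at most [8 * theta ^+ n] on the interval
    [i] of level [n], by [dyadic_chaining] with ratio [3 / 4]; and
    [8 * theta ^+ n <= 32 * theta ^+ n.+1] since [1 / 4 <= theta]. *)
Definition bad_event (gamma theta : R) (n i : nat) : set T :=
  let near_cantor_fun t :=
    near_value t (cantor_fun gamma t) (32 * theta ^+ n) in
  dyadic_jumps (cantor_left gamma n i) (gamma ^+ n) (theta ^+ n) (3 / 4)
  `|` (near_cantor_fun (cantor_left gamma n i)
       `|` near_cantor_fun (cantor_right gamma n i)).

Definition bad_paths (gamma theta : R) (m : nat) : set T :=
  \bigcup_p \bigcup_(i < 2 ^ p) bad_event gamma theta (m + p) i.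

Definition low_start (m : nat) : set T :=
  [set w | B 1 w - B 0 w \in `]0, 1 / 2 / 2 ^+ m[].

Lemma measurable_increment (A : set R) s t : measurable A ->
  measurable [set w | A (B t w - B s w)].
Proof.
move=> mA; rewrite -[X in measurable X]setTI.
by apply: (@measurable_funPT _ _ _ _ (increment B s t)).
Qed.

Lemma measurable_dyadic_jumps a l c rho : measurable (dyadic_jumps a l c rho).
Proof.
apply: measurable_bigcup_tree => j k.
exact: (measurable_increment _ _ (measurable_norm_gt _)).
Qed.

Lemma measurable_near_value t v r : measurable (near_value t v r).
Proof. exact: (@measurable_increment [set` `[_, _]]). Qed.

Lemma measurable_bad_event gamma theta n i :
  measurable (bad_event gamma theta n i).
Proof.
apply: measurableU; first exact: measurable_dyadic_jumps.
by apply: measurableU; exact: measurable_near_value.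
Qed.

Lemma measurable_bad_paths gamma theta m :
  measurable (bad_paths gamma theta m).
Proof. by apply: measurable_bigcup_tree => *; exact: measurable_bad_event. Qed.

Lemma measurable_low_start m : measurable (low_start m).
Proof. exact: (@measurable_increment [set` `]_, _[]). Qed.

Lemma oscillation_of_no_dyadic_jump w a l c rho :
  0 < a -> 0 < l -> 0 < rho < 1 ->
  {within `[0, +oo[, continuous (fun t => B t w)} ->
  ~ dyadic_jumps a l c rho w ->
  {in `[a, a + l] &, forall s t, `|B s w - B t w| <= 2 * (c / (1 - rho))}.
Proof.
move=> a0 l0 rho01 cB nojump.
have chain t : t \in `[a, a + l] -> `|B t w - B a w| <= c / (1 - rho).
  rewrite in_itv/= => /andP[a_le_t t_le].
  have tE : t = a + l * ((t - a) / l) by field; rewrite gt_eqF.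
  have -> : B a w = B (a + l * 0) w by rewrite mulr0 addr0.
  rewrite [in B t w]tE.
  apply: (@dyadic_chaining _ _ (fun u => B (a + l * u) w) _ _ _ rho01)
    => [j k k2||].
  - rewrite leNgt; apply/negP => jump; apply: nojump.
    by exists j => //; exists k.
  - by rewrite divr_ge0 ?(ltW l0) ?subr_ge0//= ler_pdivrMr// mul1r; lra.
  - have cBt : {for t, continuous (fun t => B t w)}.
      apply: (@continuous_at_gt0 _ (fun t => B t w)) => //.
      exact: lt_le_trans a_le_t.
    apply: (@continuous_comp _ _ _ (fun u => a + l * u) (fun t => B t w)).
      apply: cvgD; first exact: cvg_cst.
      by apply: cvgM; [exact: cvg_cst|exact: cvg_id].
    by rewrite -tE.
by move=> s t /chain + /chain; rewrite !ler_norml; lra.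
Qed.

Hypothesis brownianB : is_standard_brownian_motion B.

Lemma prob_brownian_increment (A : set R) s t :
  0 <= s -> s < t -> measurable A ->
  P [set w | A (B t w - B s w)] = normal_prob 0 (Num.sqrt (t - s)) A.
Proof.
by case: brownianB => _ _ normal_incr _ s0 st mA; rewrite -normal_incr.
Qed.

Lemma prob_brownian_increment_norm_gt s t u q : 0 <= s -> s < t -> 0 < u ->
  (P [set w | (u < `|B t w - B s w|)%R] <=
    (2 * (q`!%:R * (4 * (t - s) / u ^+ 2) ^+ q))%:E)%E.
Proof.
move=> s0 st u0.
rewrite (@prob_brownian_increment [set x | u < `|x|])//; last first.
  exact: measurable_norm_gt.
have ts0 : 0 < Num.sqrt (t - s) by rewrite sqrtr_gt0 subr_gt0.
apply: le_trans (normal_prob_norm_gt_le_fact q ts0 u0) _.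
by rewrite sqr_sqrtr// subr_ge0 ltW.
Qed.

Lemma prob_near_value t v r : 1 <= t -> 0 <= r ->
  (P (near_value t v r) <= (2 * r)%:E)%E.
Proof.
move=> t1 r0; rewrite (@prob_brownian_increment [set` `[_, _]])//; last by lra.
apply: le_trans (normal_prob_itvcc_le _ _ _) _.
- by rewrite subr0 -[leLHS]sqrtr1 ler_sqrt//; lra.
- lra.
- by rewrite lee_fin; lra.
Qed.

Lemma prob_low_start m :
  ((normal_pdf 0 1 1 * (1 / 2 / 2 ^+ m))%:E <= P (low_start m))%E.
Proof.
rewrite (@prob_brownian_increment [set` `]_, _[])// subr0 sqrtr1.
have pow_ge1 : 1 <= 2 ^+ m :> R by rewrite exprn_ege1// ler1n.
apply: normal_prob_itvoo_ge => //; apply/andP; split.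
  by rewrite !divr_gt0// exprn_gt0.
by rewrite ler_pdivrMr; lra.
Qed.

(* Kolmogorov's criterion with moments of order [2 * q]: at the dyadic level
   [j], the ratio of the variance to the squared threshold is proportional to
   [(2 * rho ^+ 2) ^- j]. *)
Lemma prob_dyadic_jumps a l c rho q :
  0 <= a -> 0 < l -> 0 < c -> 0 < rho -> 2 * (2 * rho ^+ 2) ^- q < 1 ->
  (P (dyadic_jumps a l c rho) <=
    (2 * (q`!%:R * (4 * (l / c ^+ 2)) ^+ q) /
      (1 - 2 * (2 * rho ^+ 2) ^- q))%:E)%E.
Proof.
move=> a0 l0 c0 rho0 rho_q.
have z0 : 0 < 2 * rho ^+ 2 by rewrite mulr_gt0 ?exprn_gt0.
apply: measure_bigcup_tree_le => //.
- by rewrite !mulr_ge0// exprn_ge0// mulr_ge0// divr_ge0 ?exprn_ge0 ?ltW.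
- by rewrite invr_gt0 exprn_gt0.
- by move=> j k; exact: (measurable_increment _ _ (measurable_norm_gt _)).
move=> j k _; have pow_gt0 : 0 < 2 ^+ j :> R by rewrite exprn_gt0.
apply: le_trans (prob_brownian_increment_norm_gt q _ _ _) _.
- by rewrite addr_ge0// mulr_ge0 ?(ltW l0)// divr_ge0// ltW.
- by rewrite ltrD2l ltr_pM2l// ltr_pM2r ?invr_gt0// ltr_nat.
- by rewrite mulr_gt0// exprn_gt0.
rewrite (_ : 4 * _ / _ = 4 * (l / c ^+ 2) * (2 * rho ^+ 2) ^- j); last first.
  rewrite -(natr1 k) [in RHS]exprMn exprAC.
  by field; rewrite !gt_eqF ?exprn_gt0.
by rewrite lee_fin exprMn !exprVn exprAC !mulrA.
Qed.

Section GoodPaths.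
Variables gamma theta : R.
Hypothesis gamma_gt0_lt_half : 0 < gamma < 1 / 2.
Hypothesis theta_ge_quarter_lt_half : 1 / 4 <= theta < 1 / 2.

Lemma isolated_zero_of_good_path m w : theta ^+ m < 1 / 16 / 2 ^+ m ->
  B 0 w = 0 -> {within `[0, +oo[, continuous (fun t => B t w)} ->
  low_start m w -> ~ bad_paths gamma theta m w ->
  isolated (zeros (fun t => B t w - cantor_fun gamma t)) !=set0.
Proof.
move=> theta_m B0 cB; rewrite /low_start/= B0 subr0 in_itv/= => start good.
have /andP[gamma0 _] := gamma_gt0_lt_half.
have /andP[theta4 theta2] := theta_ge_quarter_lt_half.
have goodE p i : (i < 2 ^ p)%N -> ~ bad_event gamma theta (m + p) i w.
  by move=> i2 bad; apply: good; exists p => //; exists i.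
have theta_pow n : 0 < theta ^+ n by rewrite exprn_gt0//; lra.
have osc p i : (i < 2 ^ p)%N -> {in cantor_itv gamma (m + p) i &,
    forall s t, `|B s w - B t w| <= 8 * theta ^+ (m + p)}.
  move=> /goodE/not_orP[nojump _] s t si ti.
  have -> : 8 * theta ^+ (m + p) = 2 * (theta ^+ (m + p) / (1 - 3 / 4)).
    by field.
  apply: (oscillation_of_no_dyadic_jump _ _ _ cB nojump) => //; last by lra.
  - exact: lt_le_trans ltr01 (cantor_left_ge1 gamma_gt0_lt_half _ _).
  - exact: exprn_gt0.
have far p t :
    ~ near_value t (cantor_fun gamma t) (32 * theta ^+ (m + p.+1)) w ->
    8 * theta ^+ (m + p) < `|B t w - cantor_fun gamma t|.
  rewrite /near_value/= B0 subr0 in_itv/= addnS exprS => /negP.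
  by have := theta_pow (m + p)%N; rewrite negb_and -!ltNge lter_normr; nra.
apply: (@isolated_zero_of_path _ (fun t => B t w) gamma m
  (fun p => 8 * theta ^+ (m + p))) => //.
- by move=> p i /goodE/not_orP[_ /not_orP[near_left _]]; exact: far.
- by move=> p i /goodE/not_orP[_ /not_orP[_ near_right]]; exact: far.
- rewrite (_ : (fun p => _) = geometric (8 * theta ^+ m) theta); last first.
    by apply/funext => p; rewrite exprD mulrA.
  by apply: cvg_geometric; rewrite ger0_norm; lra.
- by rewrite addn0 cantor_fun_left ?expn_gt0// cantor_left0 mul0r; lra.
- have := osc 0%N 0%N isT _ _ (cantor_right_itv gamma_gt0_lt_half _ _)
    (cantor_left_itv gamma_gt0_lt_half _ _).
  rewrite addn0 cantor_left0 cantor_fun_right ?expn_gt0// ler_norml.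
  by lra.
Qed.

Hypothesis gamma_lt_sqr_theta : gamma < theta ^+ 2.

Lemma prob_dyadic_jumps_cantor :
  exists2 D : R, 0 <= D & forall a n, 0 <= a ->
    (P (dyadic_jumps a (gamma ^+ n) (theta ^+ n) (3 / 4)) <=
      (D * (1 / 4) ^+ n)%:E)%E.
Proof.
have /andP[gamma0 _] := gamma_gt0_lt_half.
have theta0 : 0 < theta by have := theta_ge_quarter_lt_half; lra.
have ratio01 : 0 <= gamma / theta ^+ 2 < 1.
  by rewrite divr_ge0 ?exprn_ge0 ?ltW//= ltr_pdivrMr ?exprn_gt0// mul1r.
have /filter_ex[q [ratio_q nine_q]] : \forall q \near \oo,
    (gamma / theta ^+ 2) ^+ q < 1 / 4 /\ (8 / 9) ^+ q < 1 / 4 :> R.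
  by apply: filterI; apply: near_expr_lt; lra.
have rhoE : (2 * (3 / 4) ^+ 2) ^- q = (8 / 9) ^+ q :> R.
  by rewrite -exprVn; congr (_ ^+ q); field.
pose K : R := q`!%:R * 4 ^+ q; have K0 : 0 <= K by rewrite mulr_ge0// exprn_ge0.
exists (4 * K) => [|a n a0]; first by rewrite mulr_ge0.
have rho_q : 2 * (2 * (3 / 4) ^+ 2) ^- q < 1 :> R by rewrite rhoE; lra.
apply: le_trans (prob_dyadic_jumps a0 _ _ _ rho_q) _; rewrite ?exprn_gt0//.
rewrite lee_fin rhoE ler_pdivrMr; last by lra.
rewrite -exprM mulnC exprM -expr_div_n exprMn exprAC.
have ratio_qn : (gamma / theta ^+ 2) ^+ q ^+ n <= (1 / 4) ^+ n.
  by rewrite lerXn2r ?nnegrE ?exprn_ge0//; lra.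
have quarter_n : 0 <= K * (1 / 4) ^+ n by rewrite mulr_ge0// exprn_ge0//; lra.
rewrite (mulrA q`!%:R) -/K; apply: (@le_trans _ _ (2 * (K * (1 / 4) ^+ n))).
  by rewrite !ler_wpM2l.
by nra.
Qed.

Lemma prob_bad_event :
  exists2 D : R, 0 < D & forall n i,
    (P (bad_event gamma theta n i) <= (D * theta ^+ n)%:E)%E.
Proof.
have [D D0 jumps_le] := prob_dyadic_jumps_cantor.
have /andP[theta4 _] := theta_ge_quarter_lt_half.
exists (D + 128) => [|n i]; first by lra.
have left1 := cantor_left_ge1 gamma_gt0_lt_half n i.
have right1 := cantor_right_ge1 gamma_gt0_lt_half n i.
have r0 : 0 <= 32 * theta ^+ n by rewrite mulr_ge0// exprn_ge0//; lra.
have mJ := measurable_dyadic_jumps.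
have mN := measurable_near_value.
have mNN t v r t' v' r' := measurableU _ _ (mN t v r) (mN t' v' r').
apply: le_trans (measureU2 _ (mJ _ _ _ _) (mNN _ _ _ _ _ _)) _.
have -> : (D + 128) * theta ^+ n =
  D * theta ^+ n + (2 * (32 * theta ^+ n) + 2 * (32 * theta ^+ n)) by ring.
rewrite !EFinD; apply: leeD.
  apply: le_trans (jumps_le _ n _) _; first by rewrite (le_trans ler01).
  by rewrite lee_fin ler_wpM2l// lerXn2r ?nnegrE//; lra.
apply: le_trans (measureU2 _ (mN _ _ _) (mN _ _ _)) _.
by apply: leeD; exact: prob_near_value.
Qed.

Lemma prob_bad_paths :
  exists2 D : R, 0 < D & forall m,
    (P (bad_paths gamma theta m) <= (D * theta ^+ m)%:E)%E.
Proof.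
have [D D0 bad_le] := prob_bad_event.
have /andP[theta4 theta2] := theta_ge_quarter_lt_half.
exists (D / (1 - 2 * theta)) => [|m]; first by rewrite divr_gt0//; lra.
rewrite mulrAC; apply: measure_bigcup_tree_le => //; try by lra.
- by apply: mulr_ge0; [exact: ltW|apply: exprn_ge0; lra].
- by move=> *; exact: measurable_bad_event.
- by move=> p i _; rewrite -mulrA -exprD; exact: bad_le.
Qed.

Lemma bad_paths_lt_low_start :
  exists2 m, theta ^+ m < 1 / 16 / 2 ^+ m &
    (P (bad_paths gamma theta m) < P (low_start m))%E.
Proof.
have [D D0 bad_le] := prob_bad_paths.
have pdf0 : 0 < normal_pdf 0 1 1 / (2 * D) :> R.
  rewrite normal_pdfE ?oner_eq0// divr_gt0 ?mulr_gt0 ?expR_gt0//.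
  by rewrite normal_peak_gt0// oner_eq0.
have theta01 : 0 <= 2 * theta < 1 by have := theta_ge_quarter_lt_half; lra.
have /filter_ex[m [m16 mpdf]] : \forall m \near \oo,
    (2 * theta) ^+ m < 1 / 16 /\
    (2 * theta) ^+ m < normal_pdf 0 1 1 / (2 * D).
  by apply: filterI; apply: near_expr_lt => //; lra.
have pow_gt0 : 0 < 2 ^+ m :> R by rewrite exprn_gt0.
exists m; first by rewrite ltr_pdivlMr// mulrC -exprMn.
apply: le_lt_trans (bad_le m) _; apply: lt_le_trans (prob_low_start m).
rewrite lte_fin mulrA ltr_pdivlMr//.
by move: mpdf; rewrite ltr_pdivlMr ?mulr_gt0// exprMn; lra.
Qed.

End GoodPaths.

End Brownian.

Theorem proposition3p1 (R : realType) (d : measure_display)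
    (T : measurableType d) (P : probability T R)
    (B : R -> {RV P >-> R}) (gamma : R)
    (hB : is_standard_brownian_motion B)
    (hgamma : 0 < gamma < 1 / 4) :
  with_positive_probability P
    [set w | isolated (zeros (fun t : R => B t w - cantor_fun gamma t)) !=set0].
Proof.
have gamma_half : 0 < gamma < 1 / 2 by lra.
pose theta := 1 / 4 + gamma.
have theta_itv : 1 / 4 <= theta < 1 / 2 by rewrite /theta; lra.
have gamma_theta : gamma < theta ^+ 2.
  have : 0 < (1 / 4 - gamma) ^+ 2 by rewrite exprn_gt0//; lra.
  by rewrite /theta; lra.
have [m theta_m bad_lt] :=
  bad_paths_lt_low_start hB gamma_half theta_itv gamma_theta.
apply: with_positive_probabilityD bad_lt _.
- exact: measurable_low_start.
- exact: measurable_bad_paths.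
have [B0 _ _ cB] := hB; apply: filterS2 B0 cB => w B0w cBw start good.
exact: isolated_zero_of_good_path theta_m B0w cBw start good.
Qed.
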